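(* Let $\mathcal A$ be an injective Banach operator ideal and $1\le\lambda<\infty$. Then a Banach space $X$ has the local $\lambda$-BAP for $\mathcal A$ if and only if for every Banach space $Y$ and each operator $T\in\mathcal A(X;Y^{**})$ there exists a net $(T_\alpha)$ in $\mathcal F(X;Y^{**})$ such that $T_\alpha\to T$ pointwise and $\limsup_\alpha\|T_\alpha\|_{\mathcal A}\le\lambda\|T\|_{\mathcal A}$.
   Context: All Banach spaces are over the same field, real or complex. $\mathcal F(X;Y)$ denotes the finite rank bounded operators from $X$ to $Y$. A Banach operator ideal $(\mathcal A,\|\cdot\|_{\mathcal A})$ is injective if for every isometric embedding $J\colon Y\to Z$ and every bounded operator $T\colon X\to Y$ with $JT\in\mathcal A(X;Z)$ one has $T\in\mathcal A(X;Y)$ and $\|T\|_{\mathcal A}=\|JT\|_{\mathcal A}$. $X$ has the local $\lambda$-BAP for $\mathcal A$ if for every Banach space $Y$ and each $T\in\mathcal A(X;Y)$ there is a net $(T_\alpha)$ in $\mathcal F(X;Y)$ such that $T_\alpha\to T$ pointwise and $\limsup_\alpha\|T_\alpha\|_{\mathcal A}\le\lambda\|T\|_{\mathcal A}$. *)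

(* Defs.v *)
From HB Require Import structures.
From mathcomp Require Import all_boot all_order all_algebra complex.
From mathcomp Require Import all_classical all_reals ereal topology normedtype.

Set Implicit Arguments.
Unset Strict Implicit.
Unset Printing Implicit Defensive.

Import Order.TTheory GRing.Theory Num.Theory numFieldNormedType.Exports.
Local Open Scope classical_set_scope.
Local Open Scope ring_scope.

(* "The same field, real or complex": [scalar_field R s] is [R] or [R[i]]
   according to [s]. The norm of a [completeNormedModType (scalar_field R s)]
   takes its values in the nonnegative elements of [scalar_field R s]. *)
Inductive scalar_kind := RealScalars | ComplexScalars.

Definition scalar_numField (R : realType) (s : scalar_kind) : numFieldType :=
  match s with
  | RealScalars => R : numFieldType
  | ComplexScalars => R[i] : numFieldType
  end.

Definition scalar_field (R : realType) (s : scalar_kind) : Type :=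
  scalar_numField R s.

HB.instance Definition _ R s :=
  Num.NumField.copy (scalar_field R s) (scalar_numField R s).
HB.instance Definition _ R s :=
  NormedModule.copy (scalar_field R s) (scalar_numField R s)^o.

Section ScalarTheory.
Context {R : realType} {s : scalar_kind}.
Local Notation K := (scalar_field R s).

Definition of_real : R -> K :=
  match s return R -> scalar_field R s with
  | RealScalars => fun r => r
  | ComplexScalars => fun r => (r%:C)%C
  end.

Definition to_real : K -> R :=
  match s return scalar_field R s -> R with
  | RealScalars => fun x => x
  | ComplexScalars => fun x => complex.Re x
  end.

Lemma of_realK r : to_real (of_real r) = r.
Proof. by rewrite /to_real /of_real; case: s. Qed.

Lemma to_realK (x : K) : 0 <= x -> of_real (to_real x) = x.
Proof.
rewrite /to_real /of_real; move: x; case: s => // -[a b].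
rewrite (_ : (0 <= _) = ((0 : R[i]) <= (a +i* b)%C)) //.
by rewrite lecE /= => /andP[/eqP -> _].
Qed.

Lemma to_real_le (x y : K) : x <= y -> to_real x <= to_real y.
Proof.
rewrite /to_real; move: x y; case: s => // -[a b] [c d].
rewrite (_ : (_ <= _) = ((a +i* b)%C <= (c +i* d)%C :> R[i])) //.
by rewrite lecE /= => /andP[].
Qed.

Lemma of_real_le (x y : R) : (of_real x <= of_real y) = (x <= y).
Proof.
rewrite /of_real; case: s => //.
rewrite (_ : (_ <= _ :> scalar_field R _) = ((x%:C)%C <= (y%:C)%C :> R[i])) //.
by rewrite lecE /= eqxx.
Qed.

Lemma of_real0 : of_real 0 = 0.
Proof. by rewrite /of_real; case: s. Qed.

Lemma ge0_to_real (x : K) : 0 <= x -> 0 <= to_real x.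
Proof. by move/to_real_le; rewrite -[X in to_real X <= _]of_real0 of_realK. Qed.

End ScalarTheory.

Lemma complex_complete (R : realType) (F : set_system (R[i] : numFieldType)) :
  ProperFilter F -> cauchy F -> cvg F.
Proof.
move=> FF /cauchy_ballP Fc; apply/cvg_ex => /=.
have ReIm (x y : R[i]) (e : R) : `|x - y| < (e%:C)%C ->
    `|complex.Re x - complex.Re y| < e /\ `|complex.Im x - complex.Im y| < e.
  move=> xye; have L (a b : R) : `|a| <= Num.sqrt (a ^+ 2 + b ^+ 2).
    by rewrite -sqrtr_sqr ler_wsqrtr // lerDl sqr_ge0.
  move: xye; rewrite normc_def ltcE /= eqxx /=.
  case: x y => [a b] [c d] /= h; split; apply: le_lt_trans h; first exact: L.
  by rewrite [X in Num.sqrt X]addrC; exact: L.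
have cau (p : R[i] -> R) :
    (forall x y e, `|x - y| < (e%:C)%C -> `|p x - p y| < e) ->
    exists l : R, p @ F --> l.
  move=> hp; apply/cvg_ex.
  apply: R_complete; apply/cauchy_ballP => e e0.
  have e0C : 0 < (e%:C)%C :> R[i] by rewrite ltcE /= eqxx.
  have [[A B] /= [FA FB] AB] := Fc _ e0C.
  exists (p @` A, p @` B) => /=.
    by split; [apply: filterS FA|apply: filterS FB] => x Ax /=; exists x.
  by move=> [_ _] [/= [x Ax <-] [y By <-]]; apply: hp; exact: (AB (x, y)).
have [a Fa] := cau (@complex.Re R) (fun x y e h => (ReIm x y e h).1).
have [b Fb] := cau (@complex.Im R) (fun x y e h => (ReIm x y e h).2).
pose C : numFieldType := R[i].
exists ((a +i* b)%C : C).
case: (@cvgrPdist_lt C C^o C F FF id (a +i* b)%C) => _; apply => e.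
rewrite ltcE /= => /andP[/eqP e1 e0].
have e2 : 0 < complex.Re e / 2 by rewrite divr_gt0.
have Ha : F [set x | `|a - complex.Re x| < complex.Re e / 2].
  by move/cvgrPdist_lt: Fa => /(_ _ e2).
have Hb : F [set x | `|b - complex.Im x| < complex.Re e / 2].
  by move/cvgrPdist_lt: Fb => /(_ _ e2).
apply: filterS (filterI Ha Hb) => -[c d] /= [ac bd].
rewrite normc_def ltcE /= e1 eqxx /=.
rewrite -(@ltr_pXn2r _ 2) ?nnegrE ?sqrtr_ge0 ?ltW//.
rewrite sqr_sqrtr ?addr_ge0 ?sqr_ge0//.
rewrite -[X in X + _]real_normK ?num_real// -[X in _ + X]real_normK ?num_real//.
apply: (@le_lt_trans _ _ ((`|a - c| + `|b - d|) ^+ 2)).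
  by rewrite sqrrD -addrA lerD2l lerDr mulrn_wge0// mulr_ge0.
rewrite ltr_pXn2r ?nnegrE ?addr_ge0// 1?ltW//.
by rewrite [ltRHS](splitr (complex.Re e)) ltrD.
Qed.

Lemma scalar_complete (R : realType) (s : scalar_kind)
    (F : set_system (scalar_field R s)) : ProperFilter F -> cauchy F -> cvg F.
Proof. by case: s F; [exact: R_complete|exact: complex_complete]. Qed.

HB.instance Definition _ R s :=
  Uniform_isComplete.Build (scalar_field R s) (@scalar_complete R s).

Notation banach R s := (completeNormedModType (scalar_field R s)).

Section BoundedOperators.
Context {R : realType} {s : scalar_kind}.
Local Notation K := (scalar_field R s).

Definition bounded_linear {X Y : banach R s} : {pred X -> Y} :=
  [pred f | `[< linear f /\ exists M : K, forall x, `|f x| <= M * `|x| >]].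

Record bop (X Y : banach R s) :=
  Bop { bop_fun :> X -> Y; bop_funP : bop_fun \in bounded_linear }.

Section Space.
Variables X Y : banach R s.
Implicit Types (f g : bop X Y).

HB.instance Definition _ := [isSub for @bop_fun X Y].
HB.instance Definition _ := [Choice of bop X Y by <:].

Lemma bounded_linear_submod_closed :
  submod_closed (@bounded_linear X Y).
Proof.
split.
  apply/asboolP; split=> [a x y|]; first by rewrite /= scaler0 addr0.
  by exists 0 => x; rewrite normr0 mul0r.
move=> a f g /asboolP[lf [M fM]] /asboolP[lg [N gN]].
apply/asboolP; split=> [b x y|].
  rewrite !fctE /= lf lg !scalerDr !scalerA (mulrC b a) -!addrA; congr (_ + _).
  by rewrite addrCA.
exists (`|a| * M + N) => x; rewrite !fctE /= (le_trans (ler_normD _ _))//.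
by rewrite normrZ mulrDl lerD// -mulrA ler_wpM2l.
Qed.

HB.instance Definition _ := GRing.isSubmodClosed.Build _ _
  (@bounded_linear X Y) bounded_linear_submod_closed.
HB.instance Definition _ := [SubChoice_isSubLmodule of bop X Y by <:].

Lemma bop_linear f : linear f.
Proof. by case: f => f /= /asboolP[]. Qed.

HB.instance Definition _ f := GRing.isLinear.Build K X Y _ f (bop_linear f).

Lemma bop_bounded f : exists2 M : K, 0 <= M & forall x, `|f x| <= M * `|x|.
Proof.
case: f => f /= /asboolP[_ [M fM]].
have [[x x0]|nx] := pselect (exists x : X, x != 0).
  exists M => //; rewrite -(pmulr_lge0 (x := `|x|)) ?normr_gt0//.
  exact: le_trans (fM x).
exists 0 => // x; suff x0 : x = 0.
  by rewrite (le_trans (fM x))// x0 normr0 !mulr0.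
by apply/eqP/negP => /negP x0; apply: nx; exists x.
Qed.

Lemma bopP f g : (forall x, f x = g x) -> f = g.
Proof. by move=> fg; apply/val_inj/funext. Qed.

Definition opnorm f : K :=
  of_real (sup [set to_real `|f x| | x in [set x : X | `|x| <= 1]]).

Lemma opnorm_ge0 f : 0 <= opnorm f.
Proof.
rewrite -of_real0 of_real_le.
have [M M0 fM] := bop_bounded f.
apply: (@le_trans _ _ (to_real `|f 0|)); first exact: ge0_to_real.
apply: ub_le_sup; last by exists 0; rewrite //= normr0.
exists (to_real M) => _ /= [x x1 <-]; apply: to_real_le.
by rewrite (le_trans (fM x))// ler_piMr.
Qed.

Lemma opnormP f x : `|f x| <= opnorm f * `|x|.
Proof.
have [->|x0] := eqVneq x 0; first by rewrite linear0 !normr0 mulr0.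
have x_gt0 : 0 < `|x| by rewrite normr_gt0.
rewrite -ler_pdivrMr// mulrC -[X in X * _]ger0_norm ?invr_ge0//.
rewrite -normrZ -linearZ.
rewrite -[leLHS]to_realK// of_real_le.
have [M M0 fM] := bop_bounded f.
apply: ub_le_sup; last first.
  exists (`|x|^-1 *: x) => //=.
  by rewrite normrZ ger0_norm ?invr_ge0// mulVf ?gt_eqF.
exists (to_real M) => _ /= [y y1 <-]; apply: to_real_le.
by rewrite (le_trans (fM y))// ler_piMr.
Qed.

Lemma opnorm_le f (M : K) :
  0 <= M -> (forall x, `|f x| <= M * `|x|) -> opnorm f <= M.
Proof.
move=> M0 fM; rewrite -(to_realK M0) of_real_le; apply: ge_sup.
  by exists (to_real `|f 0|), 0; rewrite //= normr0.
move=> _ /= [x x1 <-]; apply: to_real_le.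
by rewrite (le_trans (fM x))// ler_piMr.
Qed.

Lemma opnormD f g : opnorm (f + g) <= opnorm f + opnorm g.
Proof.
apply: opnorm_le => [|x]; first by rewrite addr_ge0 ?opnorm_ge0.
by rewrite mulrDl (le_trans (ler_normD _ _))// lerD ?opnormP.
Qed.

Let opnormZ_le (a : K) f : opnorm (a *: f) <= `|a| * opnorm f.
Proof.
apply: opnorm_le => [|x]; first by rewrite mulr_ge0 ?opnorm_ge0.
by rewrite [(a *: f) x]/(a *: f x) normrZ -mulrA ler_wpM2l ?opnormP.
Qed.

Lemma opnorm_eq0 f : opnorm f = 0 -> f = 0.
Proof.
move=> f0; apply: bopP => x; apply/eqP; rewrite -normr_le0.
by rewrite (le_trans (opnormP f x))// f0 mul0r.
Qed.

Lemma opnormZ (a : K) f : opnorm (a *: f) = `|a| * opnorm f.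
Proof.
have [->|a0] := eqVneq a 0.
  apply/le_anti; rewrite opnormZ_le normr0 mul0r; exact: opnorm_ge0.
apply/le_anti; rewrite opnormZ_le /= mulrC -ler_pdivlMr ?normr_gt0// mulrC.
rewrite -normfV -[X in opnorm X <= _](scalerK a0); exact: opnormZ_le.
Qed.

HB.instance Definition _ := Lmodule_isNormed.Build K (bop X Y)
  opnormD opnormZ opnorm_eq0.

Lemma bop_complete (F : set_system (bop X Y)) :
  ProperFilter F -> cauchy F -> cvg F.
Proof.
move=> FF /cauchy_ballP Fc.
have Fx e : 0 < e -> exists2 A, F A & forall f g x, A f -> A g ->
    `|f x - g x| <= e * `|x|.
  move=> e0; have [[A B] /= [FA FB] AB] := Fc _ e0.
  exists (A `&` B); first exact: filterI.
  move=> f g x [Af _] [_ Bg].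
  have := AB (f, g) (conj Af Bg); rewrite /= -ball_normE /= => fg.
  have -> : f x - g x = (f - g : bop X Y) x by [].
  apply: le_trans (opnormP _ _) _; rewrite ler_wpM2r//; exact: ltW.
have cF x : cvg ((fun f : bop X Y => f x) @ F).
  apply: cauchy_cvg; apply/cauchy_ballP => e e0.
  have d0 : 0 < e / (`|x| + 1) by rewrite divr_gt0// ltr_wpDl.
  have [A FA hA] := Fx _ d0.
  exists ([set f x | f in A], [set f x | f in A]).
    have FA' : F ((fun f : bop X Y => f x) @^-1` [set f x | f in A]).
      by apply: filterS FA => f Af; exists f.
    by split.
  move=> [_ _] [/= [f Af <-] [g Ag <-]]; rewrite -ball_normE /=.
  rewrite (le_lt_trans (hA _ _ _ Af Ag))// mulrAC ltr_pdivrMr ?ltr_wpDl//.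
  by rewrite ltr_pM2l// ltrDl.
pose h x := lim ((fun f : bop X Y => f x) @ F).
have hE x : (fun f : bop X Y => f x) @ F --> h x by exact: cF.
have near_h e : 0 < e -> exists2 A, F A & forall f x, A f ->
    `|h x - f x| <= e * `|x|.
  move=> e0; have [A FA hA] := Fx _ e0; exists A => // f x Af.
  apply/ler_addgt0Pr => d d0.
  have Fd : F [set g | `|h x - g x| < d].
    by move/cvgrPdist_lt: (hE x) => /(_ _ d0).
  have [g [Ag hg]] := filter_ex (filterI FA Fd).
  rewrite -(subrK (g x) (h x)) -addrA (le_trans (ler_normD _ _))//.
  by rewrite [leRHS]addrC; apply: lerD; [exact: ltW|exact: hA].
have hP : h \in bounded_linear.
  apply/asboolP; split=> [a x y|].
    apply: (@cvg_unique _ (@norm_hausdorff _ Y) _ (fmap_proper_filter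
      (fun f : bop X Y => f (a *: x + y)) FF)).
      exact: hE.
    rewrite (_ : (fun f : bop X Y => _) = (fun f : bop X Y => a *: f x + f y)).
      by apply: cvgD; [apply: cvgZr; exact: hE|exact: hE].
    by apply/funext => f; rewrite linearP.
  have [A FA hA] := near_h 1 ltr01; have [f Af] := filter_ex FA.
  exists (opnorm f + 1) => x; rewrite -(subrK (f x) (h x)) addrC.
  rewrite (le_trans (ler_normD _ _))// mulrDl lerD ?opnormP//; exact: hA.
apply/cvg_ex; exists (Bop hP); apply/cvgrPdist_le => e e0.
have [A FA hA] := near_h e e0; apply: filterS FA => f Af.
by apply: opnorm_le => [|x]; [exact: ltW|exact: hA].
Qed.

HB.instance Definition _ := Uniform_isComplete.Build (bop X Y) bop_complete.

End Space.

Lemma bop_id_subproof (X : banach R s) : (id : X -> X) \in bounded_linear.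
Proof. by apply/asboolP; split=> //; exists 1 => x; rewrite mul1r. Qed.

Definition bop_id (X : banach R s) : bop X X := Bop (bop_id_subproof X).

Lemma bop_comp_subproof (X Y Z : banach R s) (g : bop Y Z) (f : bop X Y) :
  (g \o f) \in bounded_linear.
Proof.
apply/asboolP; split=> [a x y|]; first by rewrite /= !linearP.
exists (opnorm g * opnorm f) => x.
rewrite (le_trans (opnormP g _))// -mulrA ler_wpM2l ?opnorm_ge0//.
exact: opnormP.
Qed.

Definition bop_comp (X Y Z : banach R s) (g : bop Y Z) (f : bop X Y) :
  bop X Z := Bop (bop_comp_subproof g f).

Definition dual (Y : banach R s) : banach R s := bop Y (scalar_field R s).

Definition finite_rank (X Y : banach R s) (T : bop X Y) : Prop :=
  exists (n : nat) (v : 'I_n -> Y),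
    forall x, exists c : 'I_n -> K, T x = \sum_i c i *: v i.

Definition isometric_embedding (X Y : banach R s) (J : bop X Y) : Prop :=
  forall x, `|J x| = `|x|.

End BoundedOperators.

Notation "g \bo f" := (bop_comp g f) (at level 40, left associativity).

(* A Banach operator ideal in the sense of Pietsch. [ideal_norm A T] is
   constrained only when [T] belongs to [A]; like every norm over
   [scalar_field R s] it takes its values in the nonnegative scalars. That [A]
   contains all finite rank operators, and that its norm dominates the operator
   norm, follow from the axioms. *)
Record banach_ideal (R : realType) (s : scalar_kind) := BanachIdeal {
  ideal_mem : forall X Y : banach R s, set (bop X Y);
  ideal_norm : forall X Y : banach R s, bop X Y -> scalar_field R s;
  ideal_id : ideal_mem (bop_id (scalar_field R s));
  ideal_norm_id : ideal_norm (bop_id (scalar_field R s)) = 1;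
  ideal_memD : forall (X Y : banach R s) (S T : bop X Y),
    ideal_mem S -> ideal_mem T -> ideal_mem (S + T);
  ideal_memZ : forall (X Y : banach R s) (a : scalar_field R s) (T : bop X Y),
    ideal_mem T -> ideal_mem (a *: T);
  ideal_mem_comp : forall (W X Y Z : banach R s)
      (U : bop Y Z) (T : bop X Y) (S : bop W X),
    ideal_mem T -> ideal_mem (U \bo T \bo S);
  ideal_norm_ge0 : forall (X Y : banach R s) (T : bop X Y),
    ideal_mem T -> 0 <= ideal_norm T;
  ideal_norm_eq0 : forall (X Y : banach R s) (T : bop X Y),
    ideal_mem T -> ideal_norm T = 0 -> T = 0;
  ideal_normD : forall (X Y : banach R s) (S T : bop X Y),
    ideal_mem S -> ideal_mem T ->
    ideal_norm (S + T) <= ideal_norm S + ideal_norm T;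
  ideal_normZ : forall (X Y : banach R s) (a : scalar_field R s) (T : bop X Y),
    ideal_mem T -> ideal_norm (a *: T) = `|a| * ideal_norm T;
  ideal_norm_comp : forall (W X Y Z : banach R s)
      (U : bop Y Z) (T : bop X Y) (S : bop W X),
    ideal_mem T -> ideal_norm (U \bo T \bo S) <= `|U| * ideal_norm T * `|S|;
  ideal_complete : forall (X Y : banach R s) (u : nat -> bop X Y),
    (forall n, ideal_mem (u n)) ->
    (forall e : scalar_field R s, 0 < e -> exists N : nat, forall m n : nat,
       (N <= m)%N -> (N <= n)%N -> ideal_norm (u m - u n) < e) ->
    exists2 T, ideal_mem T &
      ideal_norm (u n - T) @[n --> \oo] --> (0 : scalar_field R s)
}.

Section LocalBAP.
Context {R : realType} {s : scalar_kind}.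
Variable A : banach_ideal R s.

Definition injective_ideal : Prop :=
  forall (X Y Z : banach R s) (J : bop Y Z) (T : bop X Y),
    isometric_embedding J -> ideal_mem A (J \bo T) ->
    ideal_mem A T /\ ideal_norm A T = ideal_norm A (J \bo T).

Definition directed (I : Type) (le : I -> I -> Prop) : Prop :=
  [/\ inhabited I, forall i, le i i,
      forall i j k, le i j -> le j k -> le i k
    & forall i j, exists k, le i k /\ le j k].

Definition net_filter (I : Type) (le : I -> I -> Prop) : set_system I :=
  filter_from setT (fun i => [set j | le i j]).

Definition net_limsup (I : Type) (le : I -> I -> Prop) (u : I -> \bar R) :
    \bar R :=
  ereal_inf (range (fun i => ereal_sup (u @` [set j | le i j]))).

(* A net of finite rank operators converging pointwise to [T], with
   limsup of the [A]-norms at most [lam] times that of [T]. Each [Tn i] lies in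
   [A] because it has finite rank, so its [A]-norm is meaningful. *)
Definition finite_rank_approx (lam : R) (X Y : banach R s) (T : bop X Y) :
    Prop :=
  exists (I : Type) (le : I -> I -> Prop) (Tn : I -> bop X Y),
    [/\ directed le, forall i, finite_rank (Tn i),
        forall x, Tn i x @[i --> net_filter le] --> T x
      & (net_limsup le (fun i => (to_real (ideal_norm A (Tn i)))%:E) <=
         (lam * to_real (ideal_norm A T))%:E)%E].

Definition local_bap (lam : R) (X : banach R s) : Prop :=
  forall (Y : banach R s) (T : bop X Y),
    ideal_mem A T -> finite_rank_approx lam T.

End LocalBAP.

(* Main.v *)
Require Import Defs.
From HB Require Import structures.
From mathcomp Require Import all_boot all_order all_algebra complex.
From mathcomp Require Import all_classical all_reals ereal topology normedtype.
From mathcomp Require Import ring lra.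

Set Implicit Arguments.
Unset Strict Implicit.
Unset Printing Implicit Defensive.

Import Order.TTheory GRing.Theory Num.Theory numFieldNormedType.Exports.
Local Open Scope classical_set_scope.
Local Open Scope ring_scope.

(** A bidual is a Banach space, so one implication is immediate. For the other,
    let [T : X -> Y] belong to the ideal. Composing with the canonical embedding
    of [Y] into its bidual does not increase the ideal norm, and the hypothesis
    gives finite rank operators [T' : X -> Y^**] of ideal norm almost at most
    [lam |T|] that converge pointwise to this composition. They have to be
    brought back to [Y].

    Because the ideal is injective, [T'] has the same ideal norm when it is
    regarded as an operator into a finite-dimensional space [E] inside [Y^**]
    ([finite_rank_factor]). Given finitely many [x_i] in [X] and [f_i] in [Y^*],
    the principle of local reflexivity provides [U : E -> Y] of norm at most
    [r], with [r > 1] as close to [1] as desired, such that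
    [Re sum_i f_i (U T' x_i)] is, up to an arbitrarily small error, at least
    [Re sum_i (T' x_i) (f_i)] ([local_reflexivity], [finite_rank_pull_back]).
    Only this one number has to be controlled, which makes a short proof of the
    principle possible: it is a duality argument over a finite net of the unit
    ball of [E].

    The operators [U T'] thus approximate [T] weakly. The finite rank operators
    of ideal norm at most a given bound form a convex set, so by Mazur's theorem
    some of them also approximate [T] in norm at finitely many points
    ([pointwise_approx_of_weak]). This is enough, because the existence of the
    required net is a statement about finite sets of points and tolerances
    ([finite_rank_approxP]).

    Mazur's theorem and local reflexivity both rest on the same form of the
    Hahn-Banach theorem ([sandwich]), used on finite powers of [Y] regarded as
    real vector spaces; real-linear functionals are then completed to
    functionals over the scalar field. *)

(** * The Hahn-Banach theorem for sublinear functionals *)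

Lemma linear_fun0 (F : pzRingType) (V W : lmodType F) (f : V -> W) :
  linear f -> f 0 = 0.
Proof.
by move=> lf; have := lf (-1) 0 0; rewrite scaler0 addr0 scaleN1r addNr.
Qed.

Section HahnBanach.
Context {R : realType} {V : lmodType R}.
Implicit Types (p f : V -> R) (G : V -> R -> Prop).

Definition sublinear p :=
  (forall x y, p (x + y) <= p x + p y) /\
  (forall t x, 0 < t -> p (t *: x) <= t * p x).

Definition cone G :=
  [/\ G 0 0, forall x y r q, G x r -> G y q -> G (x + y) (r + q)
    & forall t x r, 0 < t -> G x r -> G (t *: x) (t * r)].

Lemma sublinear0 p : sublinear p -> p 0 = 0.
Proof.
move=> [pD pZ]; apply/le_anti/andP; split.
  have h0 : (0 : R) < 2^-1 by rewrite invr_gt0.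
  by have := pZ _ 0 h0; rewrite scaler0; lra.
by have := pD 0 0; rewrite addr0; lra.
Qed.

Lemma sublinearZ p t x : sublinear p -> 0 < t -> p (t *: x) = t * p x.
Proof.
move=> [_ pZ] t0; apply/le_anti; rewrite pZ//= -ler_pdivlMl//.
by rewrite -{1}[x](@scalerK _ _ t) ?gt_eqF// pZ ?invr_gt0.
Qed.

Lemma sublinearN_ge p x : sublinear p -> - p (- x) <= p x.
Proof.
move=> sp; have [pD _] := sp.
by have := pD x (- x); rewrite subrr sublinear0//; lra.
Qed.

Definition ray x c (v : V) (r : R) :=
  exists2 t, 0 <= t & v = t *: x /\ r = t * c.

Lemma ray_self x c : ray x c x c.
Proof. by exists 1; rewrite ?ler01// scale1r mul1r. Qed.

Lemma cone_ray x c : cone (ray x c).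
Proof.
split; first by exists 0; rewrite // scale0r mul0r.
- move=> v w r q [t t0 [-> ->]] [u u0 [-> ->]].
  by exists (t + u); rewrite ?addr_ge0// scalerDl mulrDl.
- move=> t v r t0 [u u0 [-> ->]].
  by exists (t * u); rewrite ?mulr_ge0 ?(ltW t0)// scalerA mulrA.
Qed.

Lemma ray_le p x c v r : sublinear p -> c <= p x -> ray x c v r -> r <= p v.
Proof.
move=> sp cx [t]; rewrite le_eqVlt => /predU1P[<-|t0] [-> ->].
  by rewrite mul0r scale0r sublinear0.
by rewrite sublinearZ// ler_wpM2l// ltW.
Qed.

(** The functional [q v = inf_(G d r) (p (v + d) - r)] is the tool for both
    halves of the Hahn-Banach theorem: for [G] the ray of [(x, p x)] it shows
    that a minimal sublinear functional is odd, hence additive, and for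
    arbitrary [G] it turns the lower bounds required by [G] into an upper bound,
    so that every linear functional below [q] satisfies them. *)
Lemma sublinear_lower p G : sublinear p -> cone G ->
    (forall v r, G v r -> r <= p v) ->
  exists q, [/\ sublinear q, forall v, q v <= p v
    & forall v r, G v r -> q (- v) <= - r].
Proof.
move=> sp [G0 GD GZ] Gp; have [pD pZ] := sp.
pose A v := [set p (v + dr.1) - dr.2 | dr in [set dr : V * R | G dr.1 dr.2]].
have lbA v : has_lbound (A v).
  exists (- p (- v)) => _ [[d r] /= Gdr <-].
  by have := pD (v + d) (- v); rewrite addrC addKr; have := Gp _ _ Gdr; lra.
pose q v := inf (A v).
have q_le v d r : G d r -> q v <= p (v + d) - r.
  by move=> Gdr; apply: ge_inf => //; exists (d, r).
have le_q v c : (forall d r, G d r -> c <= p (v + d) - r) -> c <= q v.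
  move=> cp; apply: lb_le_inf; first by exists (p (v + 0) - 0), (0, 0).
  by move=> _ [[d r] /= Gdr <-]; exact: cp.
exists q; split; first split.
- move=> x y; rewrite -lerBlDr; apply: (le_q) => d r Gdr.
  suff : q (x + y) - (p (x + d) - r) <= q y by lra.
  apply: (le_q) => d' r' Gdr'; have := q_le (x + y) _ _ (GD _ _ _ _ Gdr Gdr').
  by have := pD (x + d) (y + d'); rewrite addrACA; lra.
- move=> t x t0; rewrite -ler_pdivrMl//; apply: (le_q) => d r Gdr.
  rewrite ler_pdivrMl//; have := q_le (t *: x) _ _ (GZ _ _ _ t0 Gdr).
  by rewrite -scalerDr; have := pZ t (x + d) t0; rewrite mulrBr; lra.
- by move=> v; have := q_le v _ _ G0; rewrite addr0 subr0.
- move=> v r Gvr; have := q_le (- v) _ _ Gvr.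
  by rewrite addNr sublinear0// sub0r.
Qed.

Lemma sublinear_minimal p : sublinear p ->
  exists q, [/\ sublinear q, forall v, q v <= p v
    & forall q', sublinear q' -> (forall v, q' v <= q v) -> q' = q].
Proof.
move=> sp; pose T := {q : V -> R | sublinear q /\ forall v, q v <= p v}.
pose le (a b : T) := `[< forall v, sval b v <= sval a v >].
have [|||A totA|[q [sq qp]] qmin] := @Zorn T le.
- by move=> a; apply/asboolP.
- move=> a b c /asboolP ab /asboolP bc; apply/asboolP => v.
  exact: le_trans (bc v) (ab v).
- move=> [a Pa] [b Pb] /asboolP ab /asboolP ba.
  have /= ab' : a = b by apply/funext => v; apply/le_anti; rewrite ab ba.
  by move: {ab ba} Pb; rewrite -ab' => Pb; congr exist; exact: Prop_irrelevance.
- have [[a0 Aa0]|nA] := pselect (exists a, A a); last first.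
    exists (exist _ p (conj sp (fun v => lexx _))) => a Aa.
    by exfalso; apply: nA; exists a.
  pose B v := [set sval a v | a in A].
  have lbB v : has_lbound (B v).
    exists (- p (- v)) => _ [[a [sa ap]] /= _ <-].
    by rewrite (le_trans _ (sublinearN_ge _ sa))// lerN2.
  pose q v := inf (B v).
  have q_le v a : A a -> q v <= sval a v.
    by move=> Aa; apply: ge_inf => //; exists a.
  have le_q v c : (forall a, A a -> c <= sval a v) -> c <= q v.
    move=> cp; apply: lb_le_inf; first by exists (sval a0 v), a0.
    by move=> _ [a /= Aa <-]; exact: cp.
  suff qP : sublinear q /\ forall v, q v <= p v.
    by exists (exist _ q qP) => a Aa; apply/asboolP => v /=; exact: q_le.
  split; last by move=> v; apply: le_trans (q_le _ _ Aa0) _; case: (svalP a0).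
  split.
    move=> x y; rewrite -lerBlDr; apply: (le_q) => a Aa.
    suff : q (x + y) - sval a x <= q y by lra.
    apply: (le_q) => b Ab.
    have [/asboolP ab|/asboolP ba] := totA _ _ Aa Ab.
      have [[bD _] _] := svalP b.
      by have := q_le (x + y) _ Ab; have := bD x y; have := ab x; lra.
    have [[aD _] _] := svalP a.
    by have := q_le (x + y) _ Aa; have := aD x y; have := ba y; lra.
  move=> t x t0; rewrite -ler_pdivrMl//; apply: (le_q) => a Aa.
  rewrite ler_pdivrMl//; have [[_ aZ] _] := svalP a.
  by rewrite (le_trans (q_le _ _ Aa))// aZ.
- exists q; split=> // q' sq' q'q.
  have q'p : sublinear q' /\ forall v, q' v <= p v.
    by split=> // v; exact: le_trans (q'q v) (qp v).
  by have /(congr1 sval) := qmin (exist _ q' q'p) (asboolT q'q).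
Qed.

(** A sandwich form of the Hahn-Banach theorem, after Mazur and Orlicz. Taking
    for [G] the graph of a functional on a subspace gives the extension
    theorem, and for [G] the cone over a convex set a separation theorem. *)
Theorem sandwich p G : sublinear p -> cone G ->
    (forall v r, G v r -> r <= p v) ->
  exists f, [/\ linear f, forall v, f v <= p v & forall v r, G v r -> r <= f v].
Proof.
move=> sp cG Gp; have [q0 [sq0 q0p q0G]] := sublinear_lower sp cG Gp.
have [f [sf fq0 fmin]] := sublinear_minimal sq0; have [fD _] := sf.
have fN x : f (- x) = - f x.
  have [q [sq qf qL]] :=
    sublinear_lower sf (cone_ray x (f x)) (fun v r => ray_le sf (lexx _)).
  have := qL _ _ (ray_self _ _); rewrite (fmin _ sq qf) => fNle.
  apply/le_anti; rewrite fNle/=.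
  by have := sublinearN_ge (- x) sf; rewrite opprK.
exists f; split=> [t x y||v r Gvr].
- have fadd u v : f (u + v) = f u + f v.
    apply/le_anti; rewrite fD/=.
    by have := fD (u + v) (- v); rewrite addrK fN lerBrDr.
  rewrite fadd; congr (_ + _).
  have [t0|t0|->] := ltgtP t 0.
  - by rewrite -[in LHS](opprK t) scaleNr fN sublinearZ ?oppr_gt0// mulNr opprK.
  - exact: sublinearZ.
  - by rewrite !scale0r sublinear0.
- by move=> v; exact: le_trans (fq0 v) (q0p v).
- have := le_trans (fq0 (- v)) (q0G _ _ Gvr).
  by rewrite fN lerN2.
Qed.

End HahnBanach.

(** * Real parts, real-valued norms and real restriction of scalars *)

Section Scalars.
Context {R : realType} {s : scalar_kind}.
Local Notation K := (scalar_field R s).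

Lemma to_real_is_zmod_morphism : zmod_morphism (to_real : K -> R).
Proof. by rewrite /to_real; case: s => //= -[a b] [c d]. Qed.
HB.instance Definition _ := GRing.isZmodMorphism.Build K R
  (to_real : K -> R) to_real_is_zmod_morphism.

Lemma of_real_is_zmod_morphism : zmod_morphism (of_real : R -> K).
Proof.
rewrite /of_real; case: s => // x y.
by apply/eqP; rewrite eq_complex /= subrr !eqxx.
Qed.
HB.instance Definition _ := GRing.isZmodMorphism.Build R K
  (of_real : R -> K) of_real_is_zmod_morphism.

Lemma of_real_is_monoid_morphism : monoid_morphism (of_real : R -> K).
Proof.
rewrite /of_real; case: s; split=> // x y.
apply/eqP; rewrite eq_complex /=; apply/andP; split; apply/eqP; ring.
Qed.
HB.instance Definition _ := GRing.isMonoidMorphism.Build R K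
  (of_real : R -> K) of_real_is_monoid_morphism.

Lemma of_realM r q : of_real (r * q) = of_real r * of_real q :> K.
Proof. exact: rmorphM. Qed.

Lemma of_realD r q : of_real (r + q) = of_real r + of_real q :> K.
Proof. exact: rmorphD. Qed.

Lemma of_real1 : of_real 1 = 1 :> K.
Proof. exact: rmorph1. Qed.

Lemma to_realZ r (z : K) : to_real (of_real r * z) = r * to_real z.
Proof.
rewrite /to_real /of_real; move: z; case: s => // -[a b] /=; ring.
Qed.

Lemma to_realM (x z : K) : 0 <= x -> to_real (x * z) = to_real x * to_real z.
Proof. by move=> x0; rewrite -{1}(to_realK x0) to_realZ. Qed.

Lemma to_real0 : to_real (0 : K) = 0.
Proof. exact: raddf0. Qed.

Lemma to_real1 : to_real (1 : K) = 1.
Proof. by rewrite -[1 in LHS](rmorph1 of_real) of_realK. Qed.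

Lemma of_real_ge0 r : (0 <= of_real r :> K) = (0 <= r).
Proof. by rewrite -[0 in LHS]of_real0 of_real_le. Qed.

Lemma of_real_gt0 r : (0 < of_real r :> K) = (0 < r).
Proof. by rewrite !lt0r of_real_ge0 fmorph_eq0. Qed.

Lemma to_real_gt0 (x : K) : 0 < x -> 0 < to_real x.
Proof. by move=> x0; rewrite -(@of_real_gt0) to_realK ?ltW. Qed.

(** This is what turns estimates of real parts of functionals into estimates of
    their moduli. *)
Lemma rotation (z : K) : exists2 u : K, `|u| <= 1 & u * z = `|z|.
Proof.
have [->|z0] := eqVneq z 0; first by exists 0; rewrite ?normr0 ?mul0r ?ler01.
exists (`|z| / z); last by rewrite divfK.
by rewrite normf_div normr_id divff// normr_eq0.
Qed.

Lemma to_real_le_norm (z : K) : to_real z <= to_real `|z|.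
Proof.
rewrite /to_real; move: z; case: s; first exact: ler_norm.
move=> -[a b]; rewrite (_ : `|_| = (`|(a +i* b)%C| : R[i]))// normc_def /=.
rewrite (le_trans (ler_norm a))// -sqrtr_sqr ler_wsqrtr // lerDl.
exact: sqr_ge0.
Qed.

End Scalars.

Section RealNorm.
Context {R : realType} {s : scalar_kind}.
Local Notation K := (scalar_field R s).
Context {V : normedModType K}.
Implicit Types (x y : V).

Definition rnorm x : R := to_real `|x|.

Lemma of_real_rnorm x : of_real (rnorm x) = `|x|.
Proof. exact: to_realK. Qed.

Lemma rnorm_ge0 x : 0 <= rnorm x.
Proof. exact: ge0_to_real. Qed.

Lemma rnormZ (a : K) x : rnorm (a *: x) = to_real `|a| * rnorm x.
Proof. by rewrite /rnorm normrZ to_realM. Qed.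

Lemma rnorm_realZ r x : 0 <= r -> rnorm (of_real r *: x) = r * rnorm x.
Proof. by move=> r0; rewrite rnormZ ger0_norm ?of_realK// of_real_ge0. Qed.

Lemma ler_rnormD x y : rnorm (x + y) <= rnorm x + rnorm y.
Proof. by rewrite /rnorm -raddfD; apply: to_real_le; exact: ler_normD. Qed.

Lemma rnormN x : rnorm (- x) = rnorm x.
Proof. by rewrite /rnorm normrN. Qed.

Lemma rnorm0 : rnorm (0 : V) = 0.
Proof. by rewrite /rnorm normr0 raddf0. Qed.

Lemma rnorm_eq0 x : rnorm x = 0 -> x = 0.
Proof.
by move=> x0; apply/eqP; rewrite -normr_eq0 -of_real_rnorm x0 of_real0.
Qed.

Lemma rnorm_gt0 x : (0 < rnorm x) = (x != 0).
Proof.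
rewrite lt0r rnorm_ge0 andbT; congr (~~ _); apply/eqP/eqP => [|->].
  exact: rnorm_eq0.
exact: rnorm0.
Qed.

Lemma rnorm_le x r : (rnorm x <= r) = (`|x| <= of_real r).
Proof. by rewrite -of_real_rnorm of_real_le. Qed.

End RealNorm.

Section Realified.
Context {R : realType} {s : scalar_kind}.
Local Notation K := (scalar_field R s).

(** A copy of [V], so that its real structure does not compete with the given
    one. *)
Definition realified (V : lmodType K) : Type := V.

Section Instances.
Variable V : lmodType K.
HB.instance Definition _ := GRing.Zmodule.on (realified V).

Definition real_scale (r : R) (v : realified V) : realified V :=
  of_real r *: (v : V).

Fact real_scaleA a b v : real_scale a (real_scale b v) = real_scale (a * b) v.
Proof. by rewrite /real_scale scalerA rmorphM. Qed.
Fact real_scale1 : left_id 1 real_scale.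
Proof. by move=> v; rewrite /real_scale rmorph1 scale1r. Qed.
Fact real_scaleDr : right_distributive real_scale +%R.
Proof. by move=> a u v; rewrite /real_scale scalerDr. Qed.
Fact real_scaleDl v : {morph real_scale^~ v : a b / a + b}.
Proof. by move=> a b; rewrite /real_scale rmorphD scalerDl. Qed.

HB.instance Definition _ := GRing.Zmodule_isLmodule.Build R (realified V)
  real_scaleA real_scale1 real_scaleDr real_scaleDl.
End Instances.

End Realified.

(** In the complex case [f v = u v - i u (i v)]. *)
Lemma complexification (R : realType) (s : scalar_kind)
    (V : lmodType (scalar_field R s)) (u : realified V -> R) : linear u ->
  exists2 f : V -> scalar_field R s, linear f & forall v,
    to_real (f v) = u v.
Proof.
move: V u; case: s => V u lu; first by exists u.
pose i : scalar_field R ComplexScalars := ('i)%C.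
have uD x y : u (x + y) = u x + u y.
  by have := lu 1 x y; rewrite !scale1r.
have uZ (r : R) (x : V) : u ((of_real r : scalar_field R ComplexScalars) *: x)
     = r * u x.
  by have := lu r x 0; rewrite addr0 (linear_fun0 lu) addr0.
have uN x : u (- x) = - u x.
  by apply: (addrI (u x)); rewrite -uD !subrr (linear_fun0 lu).
exists (fun v => (u v +i* - u (i *: v))%C : scalar_field R ComplexScalars)
  => //.
move=> a x y.
have aE : a = of_real (complex.Re a) + of_real (complex.Im a) * i.
  case: a => a b; apply/eqP; rewrite eq_complex /=.
  by apply/andP; split; apply/eqP; ring.
have iE : i * i = -1.
  by apply/eqP; rewrite eq_complex /=; apply/andP; split; apply/eqP; ring.
set p := complex.Re a in aE *; set q := complex.Im a in aE *.
have Ea (z : V) : a *: z = of_real p *: z + of_real q *: (i *: z).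
  by rewrite aE scalerDl scalerA.
rewrite scalerDr (scalerA i a) (mulrC i a) -(scalerA a i) !Ea.
rewrite [i *: (i *: x)]scalerA iE scaleN1r !uD !uZ uN.
apply/eqP; rewrite eq_complex /=.
case: a @p @q aE Ea => a b /= _ _; apply/andP; split; apply/eqP; ring.
Qed.

(** * Functionals on Banach spaces *)

Section Functionals.
Context {R : realType} {s : scalar_kind}.
Local Notation K := (scalar_field R s).
Implicit Types (X Y Z : banach R s).

Lemma bopDE X Y (S T : bop X Y) x : (S + T) x = S x + T x.
Proof. by []. Qed.

Lemma bopZE X Y (a : K) (T : bop X Y) x : (a *: T) x = a *: T x.
Proof. by []. Qed.

Lemma bopNE X Y (T : bop X Y) x : (- T) x = - T x.
Proof. by []. Qed.

Lemma bop0E X Y x : (0 : bop X Y) x = 0.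
Proof. by []. Qed.

Lemma bop_sumE X Y (I : Type) (r : seq I) (F : I -> bop X Y) x :
  (\sum_(i <- r) F i) x = \sum_(i <- r) F i x.
Proof. by elim/big_rec2 : _ => // i y T _ <-. Qed.

Lemma rnorm_bop X Y (T : bop X Y) x : rnorm (T x) <= rnorm T * rnorm x.
Proof. by rewrite rnorm_le of_realM !of_real_rnorm; exact: opnormP. Qed.

Lemma rnorm_bop_le X Y (T : bop X Y) c : 0 <= c ->
  (forall x, rnorm (T x) <= c * rnorm x) -> rnorm T <= c.
Proof.
move=> c0 Tc; rewrite rnorm_le; apply: opnorm_le => [|x].
  by rewrite of_real_ge0.
by rewrite -of_real_rnorm -[`|x|]of_real_rnorm -of_realM of_real_le.
Qed.

Lemma rank1_subproof X Y (f : dual X) (y : Y) :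
  (fun x => f x *: y) \in bounded_linear.
Proof.
apply/asboolP; split=> [a u v|]; first by rewrite linearP scalerDl scalerA.
exists (`|f| * `|y|) => x.
by rewrite normrZ mulrAC ler_wpM2r//; exact: opnormP.
Qed.

Definition rank1 X Y (f : dual X) (y : Y) : bop X Y := Bop (rank1_subproof f y).

(** Rotating [f v] onto the positive half-line gives [|f v| = Re f (u v)] for a
    scalar [u] of modulus at most one. *)
Lemma rnorm_le_of_re (V : normedModType K) (f : V -> K) c :
  linear f -> 0 <= c ->
  (forall v, to_real (f v) <= c * rnorm v) ->
  forall v, rnorm (f v) <= c * rnorm v.
Proof.
move=> lf c0 fc v; have [u u1 uf] := rotation (f v).
have fu : f (u *: v) = u * f v.
  by have := lf u v 0; rewrite (linear_fun0 lf) !addr0.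
rewrite /rnorm -uf -fu (le_trans (fc _))// ler_wpM2l// rnormZ.
by rewrite ler_piMl ?rnorm_ge0// -(@to_real1 R s) to_real_le.
Qed.

Lemma dual_of_real_functional Y (u : realified Y -> R) c : linear u ->
    (forall y, u y <= c * rnorm (y : Y)) ->
  exists h : dual Y, forall y, to_real (h y) = u y.
Proof.
move=> lu uc; have [f lf fu] := complexification lu.
have fb : f \in bounded_linear.
  apply/asboolP; split=> //; exists (of_real `|c|) => y.
  rewrite -[`|y|]of_real_rnorm -of_realM -rnorm_le.
  apply: rnorm_le_of_re => // v; rewrite fu (le_trans (uc v))//.
  by rewrite ler_wpM2r ?rnorm_ge0// ler_norm.
by exists (Bop fb).
Qed.

(** Both Hahn-Banach arguments take place in a finite power of a Banach space;
    this brings their outcome back to functionals on the space itself. The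
    hypothesis is continuity, expressed with the sum norm. *)
Lemma dual_of_real_functional_ffun Y (I : finType)
    (u : realified {ffun I -> Y} -> R) c : linear u ->
    (forall z : {ffun I -> Y}, u z <= c * \sum_i rnorm (z i)) ->
  exists h : I -> dual Y, forall z, u z = \sum_i to_real (h i (z i)).
Proof.
move=> lu uc; pose d i (y : Y) : {ffun I -> Y} := [ffun j => (j == i)%:R *: y].
have uD x y : u (x + y) = u x + u y.
  by have := lu 1 x y; rewrite !scale1r.
have /fin_all_exists[h hu] i :
    exists h : dual Y, forall y, to_real (h y) = u (d i y).
  apply: (@dual_of_real_functional _ (fun y => u (d i y)) c) => [a x y|y].
    rewrite -lu; congr u; apply/ffunP => j; rewrite !ffunE.
    by rewrite [X in _ *: (X + _)]/(_ *: _)/= scalerDr !scalerA mulrC.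
  rewrite (le_trans (uc _))// (bigD1 i)//= big1 ?addr0 => [|j /negPf ji].
    by rewrite ffunE eqxx scale1r.
  by rewrite ffunE ji scale0r rnorm0.
exists h => z; have {1}-> : z = \sum_i d i (z i).
  apply/ffunP => j; rewrite sum_ffunE (bigD1 j)//= big1 ?addr0 => [|i ij].
    by rewrite ffunE eqxx scale1r.
  by rewrite ffunE eq_sym (negPf ij) scale0r.
by rewrite (big_morph u uD (linear_fun0 lu)); apply: eq_bigr => i _; rewrite hu.
Qed.

Lemma sublinear_sum_rnorm (V : normedModType K) (I : finType) :
  sublinear (fun z : realified {ffun I -> V} =>
               \sum_i rnorm ((z : {ffun I -> V}) i)).
Proof.
split=> [x y|t x t0].
  by rewrite -big_split/=; apply: ler_sum => i _; rewrite ffunE ler_rnormD.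
rewrite mulr_sumr; apply: ler_sum => i _.
by rewrite ffunE rnorm_realZ// ltW.
Qed.

Lemma sublinear_rnorm (V : normedModType K) :
  sublinear (fun z : realified V => rnorm (z : V)).
Proof.
split=> [x y|t x t0]; first exact: ler_rnormD.
by rewrite rnorm_realZ// ltW.
Qed.

Lemma dual_separates Z (z : Z) : z != 0 -> exists h : dual Z, h z != 0.
Proof.
move=> z0; have z_gt0 : 0 < rnorm z by rewrite rnorm_gt0.
have [u [lu uz uray]] := sandwich (sublinear_rnorm Z)
  (cone_ray (z : realified Z) (rnorm z))
  (fun v r => ray_le (sublinear_rnorm Z) (lexx _)).
have [|h hu] := @dual_of_real_functional _ u 1 lu.
  by move=> y; rewrite mul1r.
exists h; apply: contraTneq z_gt0 => hz; rewrite -leNgt.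
rewrite -(@to_real0 R s) -hz hu; apply: uray.
exact: ray_self.
Qed.

(** Mazur's theorem for the pointwise topology. Were the tuples
    [(S x_i - T x_i)_i], for [S] in [C], to stay away from [0] in [Y^n], a
    continuous functional on [Y^n] would be bounded below by [e > 0] on all of
    them, and its components would contradict the weak approximation. *)
Lemma pointwise_approx_of_weak X Y (C : set (bop X Y)) (T : bop X Y) :
    (forall (S S' : bop X Y) t, 0 <= t -> t <= 1 -> C S -> C S' ->
       C (of_real t *: S + of_real (1 - t) *: S')) ->
    (forall n (x : 'I_n -> X) (f : 'I_n -> dual Y) e, 0 < e ->
       exists2 S, C S & \sum_i to_real (f i (T (x i))) - e
                        <= \sum_i to_real (f i (S (x i)))) ->
  forall n (x : 'I_n -> X) e, 0 < e ->
    exists2 S, C S & forall i, rnorm (S (x i) - T (x i)) <= e.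
Proof.
move=> convC weakC n x e e0; apply: contrapT => far.
pose D (S : bop X Y) : realified {ffun 'I_n -> Y} :=
  [ffun i => S (x i) - T (x i)].
pose p (z : realified {ffun 'I_n -> Y}) :=
  \sum_i rnorm ((z : {ffun 'I_n -> Y}) i).
have pD S : C S -> e <= p (D S).
  move=> CS; rewrite leNgt; apply/negP => pe; apply: far; exists S => // i.
  rewrite ltW// (le_lt_trans _ pe)// /p (bigD1 i)//= ffunE lerDl.
  by apply: sumr_ge0 => j _; exact: rnorm_ge0.
(* The cone over [{D S | S in C} x {e}]: a functional above it is at least [e]
   on every [D S]. *)
pose G v r := v = 0 /\ r = 0 \/
  exists t S, [/\ 0 < t, C S, v = t *: D S & r = t * e].
have cG : cone G.
  split; first by left.
  - move=> v w r c [[-> ->]|[t [S [t0 CS -> ->]]]]; first by rewrite !add0r.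
    case=> [[-> ->]|[t' [S' [t'0 CS' -> ->]]]].
      by rewrite !addr0; right; exists t, S.
    have tt0 : 0 < t + t' by rewrite addr_gt0.
    right; exists (t + t').
    exists (of_real (t / (t + t')) *: S + of_real (1 - t / (t + t')) *: S').
    split=> //; last by rewrite mulrDl.
      apply: convC => //; first by rewrite divr_ge0 ?ltW.
      by rewrite ler_pdivrMr// mul1r lerDl ltW.
    have tE : (t + t') * (t / (t + t')) = t by rewrite mulrC divfK// gt_eqF.
    apply/ffunP => i; rewrite !ffunE bopDE !bopZE.
    rewrite -[T (x i) in RHS]scale1r.
    have -> : 1 = of_real (t / (t + t')) + of_real (1 - t / (t + t')) :> K.
      by rewrite -of_realD addrC subrK of_real1.
    rewrite scalerDl opprD addrACA -!scalerBr [RHS]scalerDr !scalerA -!of_realM.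
    by rewrite tE mulrBr tE mulr1 [t + t']addrC addrK.
  - move=> t v r t0 [[-> ->]|[u [S [u0 CS -> ->]]]].
      by left; rewrite scaler0 mulr0.
    by right; exists (t * u), S; rewrite mulr_gt0// scalerA mulrA.
have Gp v r : G v r -> r <= p v.
  move=> [[-> ->]|[t [S [t0 CS -> ->]]]].
    by apply: sumr_ge0 => i _; exact: rnorm_ge0.
  have -> : p (t *: D S) = t * p (D S).
    exact: (sublinearZ (D S) (sublinear_sum_rnorm Y 'I_n) t0).
  by rewrite ler_wpM2l ?pD// ltW.
have [u [lu up Gu]] := sandwich (sublinear_sum_rnorm _ _) cG Gp.
have [|h hu] := @dual_of_real_functional_ffun _ _ u 1 lu.
  by move=> z; rewrite mul1r; exact: up.
have e20 : 0 < e / 2 by rewrite divr_gt0.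
have [S CS] := weakC n x (fun i => - h i) _ e20.
have : e <= u (D S).
  by apply: Gu; right; exists 1, S; rewrite scale1r mul1r.
rewrite hu.
under eq_bigr do rewrite ffunE linearB raddfB.
have hN U : \sum_i to_real ((- h i : dual Y) (U i))
    = - \sum_i to_real (h i (U i)).
  rewrite -sumrN; apply: eq_bigr => i _; exact: (raddfN (to_real : K -> R)).
rewrite sumrB !hN; lra.
Qed.

End Functionals.

(** * Finite-dimensional Banach spaces *)

Lemma real_grid (R : realType) (M d : R) : 0 < d ->
  exists g : seq R, forall x, `|x| <= M -> exists2 a, a \in g & `|x - a| <= d.
Proof.
move=> d0.
exists [seq - M + k%:R * d | k <- iota 0 (Num.truncn (2 * M / d)).+1].
move=> x xM; have /andP[Mx xM'] : - M <= x <= M by rewrite -ler_norml.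
have k0 : 0 <= (x + M) / d by rewrite divr_ge0 ?(ltW d0)//; lra.
pose k := Num.truncn ((x + M) / d).
exists (- M + k%:R * d).
  apply/mapP; exists k => //; rewrite mem_iota add0n ltnS.
  by apply: le_truncn; rewrite ler_pM2r ?invr_gt0//; lra.
have k1 : k%:R <= (x + M) / d by rewrite Num.Theory.truncn_le.
have k2 : (x + M) / d < k.+1%:R by rewrite -Num.Theory.truncn_le_nat.
rewrite ler_pdivlMr// in k1; rewrite ltr_pdivrMr// mulrSr mulrDl mul1r in k2.
by rewrite ler_norml; lra.
Qed.

Lemma scalar_grid (R : realType) (s : scalar_kind) (M d : R) : 0 < d ->
  exists g : seq (scalar_field R s), forall z : scalar_field R s,
    rnorm z <= M -> exists2 a, a \in g & rnorm (z - a) <= d.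
Proof.
case: s => d0; first exact: real_grid.
have d20 : 0 < d / 2 by rewrite divr_gt0.
have [g hg] := real_grid M d20.
exists [seq (a +i* b)%C : scalar_field R ComplexScalars | a <- g, b <- g].
move=> -[x y].
have normE (u v : R) :
      rnorm ((u +i* v)%C : scalar_field R ComplexScalars)
      = Num.sqrt (u ^+ 2 + v ^+ 2).
  by rewrite /rnorm (_ : `|_| = (`|(u +i* v)%C| : R[i]))// normc_def.
rewrite normE => xyM.
have [|a ag xa] := hg x.
  by rewrite (le_trans _ xyM)// -sqrtr_sqr ler_wsqrtr // lerDl sqr_ge0.
have [|b bg yb] := hg y.
  by rewrite (le_trans _ xyM)// -sqrtr_sqr ler_wsqrtr // lerDr sqr_ge0.
exists ((a +i* b)%C); first by apply/allpairsP; exists (a, b).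
rewrite [X in rnorm X](_ : _ = ((x - a) +i* (y - b))%C)// normE.
rewrite (@le_trans _ _ (`|x - a| + `|y - b|))//; last by lra.
rewrite -(@ler_pXn2r _ 2) ?nnegrE ?sqrtr_ge0 ?addr_ge0//.
rewrite sqr_sqrtr ?addr_ge0 ?sqr_ge0//.
rewrite -[X in X + _]real_normK ?num_real// -[X in _ + X]real_normK ?num_real//.
by rewrite sqrrD -addrA lerD2l lerDr mulrn_wge0// mulr_ge0.
Qed.

Section FiniteDimensional.
Context {R : realType} {s : scalar_kind}.
Local Notation K := (scalar_field R s).
Implicit Types (X Y Z E : banach R s).

Definition finite_op X Y (l : seq (dual X * Y)) : bop X Y :=
  \sum_(q <- l) rank1 q.1 q.2.

Lemma finite_opE X Y (l : seq (dual X * Y)) x :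
  finite_op l x = \sum_(q <- l) q.1 x *: q.2.
Proof. exact: bop_sumE. Qed.

(** Finite rank of the identity, with continuous coordinates. *)
Definition finite_dimensional E : Prop :=
  exists l : seq (dual E * E), forall w, finite_op l w = w.

(** The coordinates of the unit ball are bounded, so grids of scalars give
    finitely many points of [E] near all of it; replacing each of them by a
    nearby vector of the ball, if there is one, doubles the distance. *)
Lemma unit_ball_net E e : finite_dimensional E -> 0 < e ->
  exists b : seq E, (forall v, v \in b -> rnorm v <= 1) /\
    forall w, rnorm w <= 1 -> exists2 v, v \in b & rnorm (w - v) <= e.
Proof.
move=> [l lE] e0.
have [|N hN] : 0 < e / 2 -> exists N : seq E, forall w, rnorm w <= 1 ->
    exists2 v, v \in N & rnorm (finite_op l w - v) <= e / 2.
- elim: l {lE} (e / 2) => [|q l IHl] d d0.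
    exists [:: 0] => w _; exists 0; first by rewrite inE.
    by rewrite finite_opE big_nil subrr rnorm0 ltW.
  have d20 : 0 < d / 2 by rewrite divr_gt0.
  have [N hN] := IHl _ d20.
  have q0 : 0 < rnorm q.2 + 1 by rewrite ltr_wpDl ?rnorm_ge0.
  have dq0 : 0 < d / 2 / (rnorm q.2 + 1) by rewrite divr_gt0.
  have [g hg] := scalar_grid s (rnorm q.1) dq0.
  exists [seq a *: q.2 + v | a <- g, v <- N] => w w1.
  have [v vN wv] := hN w w1.
  have [|a ag wa] := hg (q.1 w).
    by rewrite (le_trans (rnorm_bop _ _))// ler_piMr// rnorm_ge0.
  exists (a *: q.2 + v); first by apply/allpairsP; exists (a, v).
  rewrite finite_opE big_cons -finite_opE opprD addrACA -scalerBl.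
  rewrite (le_trans (ler_rnormD _ _))// [leRHS](splitr d) lerD//.
  rewrite rnormZ (le_trans (ler_wpM2r (rnorm_ge0 _) wa))//.
  rewrite mulrAC ler_pdivrMr// ler_wpM2l ?(ltW d20)//.
  by rewrite lerDl.
- by rewrite divr_gt0.
have /choice[c hc] v : exists cv : E, rnorm cv <= 1 /\
    ((exists2 w, rnorm w <= 1 & rnorm (w - v) <= e / 2) ->
     rnorm (cv - v) <= e / 2).
  have [[w w1 wv]|nw] :=
    pselect (exists2 w, rnorm w <= 1 & rnorm (w - v) <= e / 2).
    by exists w.
  by exists 0; split; [rewrite rnorm0|move=> /nw].
exists [seq c v | v <- N]; split=> [_ /mapP[v _ ->]|w w1].
  by case: (hc v).
have [v vN] := hN w w1; rewrite lE => wv.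
exists (c v); first exact: map_f.
have [_ /(_ (ex_intro2 _ _ w w1 wv)) cv] := hc v.
rewrite -(subrK v w) -addrA (le_trans (ler_rnormD _ _))//.
by rewrite [leRHS](splitr e) lerD// -rnormN opprB.
Qed.

(** On the unit ball [|U w| <= |U v| + |U (w - v)| <= M + e |U|]; take the
    supremum over [w]. *)
Lemma rnorm_bop_net E Y (U : bop E Y) (b : seq E) e M :
    e < 1 -> 0 <= M ->
    (forall w, rnorm w <= 1 -> exists2 v, v \in b & rnorm (w - v) <= e) ->
    (forall v, v \in b -> rnorm (U v) <= M) ->
  (1 - e) * rnorm U <= M.
Proof.
move=> e1 M0 bnet UM.
have e0 : 0 <= e.
  have [|v _ ve] := bnet 0; first by rewrite rnorm0.
  exact: le_trans (rnorm_ge0 _) ve.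
suff : rnorm U <= M + e * rnorm U by lra.
apply: rnorm_bop_le => [|x]; first by rewrite addr_ge0// mulr_ge0// rnorm_ge0.
have [->|x0] := eqVneq x 0; first by rewrite linear0 !rnorm0 mulr0.
have x_gt0 : 0 < rnorm x by rewrite rnorm_gt0.
pose w := of_real (rnorm x)^-1 *: x.
have w1 : rnorm w <= 1.
  by rewrite rnorm_realZ ?invr_ge0 ?rnorm_ge0// mulVf ?gt_eqF.
have [v vb wv] := bnet w w1.
rewrite -ler_pdivrMr// mulrC.
have -> : (rnorm x)^-1 * rnorm (U x) = rnorm (U w).
  by rewrite linearZ rnorm_realZ// invr_ge0 rnorm_ge0.
rewrite -(subrK v w) addrC linearD (le_trans (ler_rnormD _ _))//.
rewrite lerD ?UM// (le_trans (rnorm_bop _ _))// mulrC.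
by rewrite ler_wpM2r ?rnorm_ge0.
Qed.

End FiniteDimensional.

Section FixedSpace.
Context {R : realType} {s : scalar_kind}.
Local Notation K := (scalar_field R s).
Variables (Z : banach R s) (P : bop Z Z).

Definition fixed_by : {pred Z} := [pred z | P z == z].

(** A finite-dimensional subspace of [Z] is the range of a bounded projection,
    hence of this form, and then its completeness is just continuity of [P]. *)
Record fixed_space :=
  FixedSpace { fixed_val :> Z; fixed_valP : fixed_val \in fixed_by }.

HB.instance Definition _ := [isSub for fixed_val].
HB.instance Definition _ := [Choice of fixed_space by <:].

Lemma fixed_by_submod_closed : submod_closed fixed_by.
Proof.
split; first by rewrite inE linear0.
by move=> a x y /eqP Px /eqP Py; rewrite inE linearP/= Px Py.
Qed.

HB.instance Definition _ := GRing.isSubmodClosed.Build _ _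
  fixed_by fixed_by_submod_closed.
HB.instance Definition _ := [SubChoice_isSubLmodule of fixed_space by <:].

Definition fixed_norm (z : fixed_space) : K := `|fixed_val z|.

Lemma fixed_normD x y : fixed_norm (x + y) <= fixed_norm x + fixed_norm y.
Proof. exact: ler_normD. Qed.

Lemma fixed_normZ a x : fixed_norm (a *: x) = `|a| * fixed_norm x.
Proof. exact: normrZ. Qed.

Lemma fixed_norm_eq0 x : fixed_norm x = 0 -> x = 0.
Proof. by move=> /normr0_eq0 x0; apply/val_inj. Qed.

HB.instance Definition _ := Lmodule_isNormed.Build K fixed_space
  fixed_normD fixed_normZ fixed_norm_eq0.

Lemma bop_continuous (X Y : banach R s) (T : bop X Y) : continuous T.
Proof.
move=> x; apply/cvgrPdist_le => e e0.
have n0 : 0 < `|T| + 1 by rewrite ltr_wpDl.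
near=> y.
rewrite -linearB (le_trans (opnormP T _))//.
rewrite (@le_trans _ _ ((`|T| + 1) * `|x - y|))//.
  by rewrite ler_wpM2r// lerDl.
rewrite mulrC -ler_pdivlMr//.
near: y; apply: cvgr_dist_le => //; exact: divr_gt0.
Unshelve. all: by end_near. Qed.

Lemma fixed_space_complete (F : set_system fixed_space) :
  ProperFilter F -> cauchy F -> cvg F.
Proof.
move=> FF /cauchy_ballP Fc.
have cF : cvg (fixed_val @ F).
  apply: cauchy_cvg; apply/cauchy_ballP => e e0.
  have [[A B] /= [FA FB] AB] := Fc _ e0.
  exists (fixed_val @` A, fixed_val @` B) => /=.
    by split; [apply: filterS FA|apply: filterS FB] => x Ax /=; exists x.
  move=> [_ _] [/= [x Ax <-] [y By <-]].
  by have := AB (x, y) (conj Ax By); rewrite /= -!ball_normE.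
set z := lim (fixed_val @ F) in cF.
have zP : z \in fixed_by.
  apply/eqP; apply: (@cvg_unique _ (@norm_hausdorff _ Z) (fixed_val @ F)) => //.
  rewrite (_ : fixed_val = P \o fixed_val); last first.
    by apply/funext => -[y yP] /=; rewrite (eqP yP).
  by apply: cvg_comp cF _; exact: bop_continuous.
apply/cvg_ex; exists (FixedSpace zP); apply/cvgrPdist_le => e e0.
by move/cvgrPdist_le : cF => /(_ _ e0).
Qed.

HB.instance Definition _ :=
  Uniform_isComplete.Build fixed_space fixed_space_complete.

Definition fixed_banach : banach R s := fixed_space.

Lemma fixed_incl_subproof :
  (fixed_val : fixed_banach -> Z) \in bounded_linear.
Proof. by apply/asboolP; split=> //; exists 1 => x; rewrite mul1r. Qed.

Definition fixed_incl : bop fixed_banach Z := Bop fixed_incl_subproof.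

End FixedSpace.

Section Factorization.
Context {R : realType} {s : scalar_kind}.
Local Notation K := (scalar_field R s).
Implicit Types (X Y Z E : banach R s).

(** The projection grows by one vector [x] at a time: if [w = x - P x] is not
    [0], choose [h] with [h w = 1] and add the term [h (y - P y) w] to [P y]. *)
Lemma finite_rank_projection Z (v : seq Z) :
  exists l : seq (dual Z * Z),
    (forall q, q \in l -> finite_op l q.2 = q.2) /\
    forall x, x \in v -> finite_op l x = x.
Proof.
elim: v => [|x v [l [lfix vfix]]]; first by exists [::].
set P := finite_op l in lfix vfix.
have [Px|] := eqVneq (x - P x) 0.
  exists l; split=> // y; rewrite inE => /predU1P[->|/vfix//].
  by apply/eqP; rewrite eq_sym -subr_eq0 Px.
set w := x - P x => w0; have [h hw] := dual_separates w0.
have PP y : P (P y) = P y.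
  rewrite [P y]finite_opE linear_sum.
  by apply: eq_big_seq => q ql; rewrite linearZ/= lfix.
have Pw : P w = 0 by rewrite /w linearB/= PP subrr.
pose k : dual Z := (h w)^-1 *: (h - h \bo P).
have kE y : k y = (h w)^-1 * h (y - P y) by rewrite [h (y - P y)]linearB.
have kfix y : P y = y -> k y = 0.
  by move=> Py; rewrite kE Py subrr linear0 mulr0.
have kP y : finite_op ((k, w) :: l) y = k y *: w + P y.
  by rewrite finite_opE big_cons -finite_opE.
exists ((k, w) :: l); split=> [q|y]; rewrite inE => /predU1P[->|qlv].
- by rewrite -[(k, w).2]/w kP Pw addr0 kE Pw subr0 mulVf// scale1r.
- by rewrite kP kfix lfix// scale0r add0r.
- by rewrite kP kE -/w mulVf// scale1r subrK.
- by rewrite kP kfix vfix// scale0r add0r.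
Qed.

(** The middle space is the range of a projection that fixes the finitely many
    vectors spanning the range of [S]. *)
Lemma finite_rank_factor X Z (S : bop X Z) : finite_rank S ->
  exists (E : banach R s) (J : bop E Z) (S0 : bop X E),
    [/\ isometric_embedding J, finite_dimensional E & S = J \bo S0].
Proof.
move=> [n [v Sv]]; have [l [lfix vfix]] := finite_rank_projection (codom v).
set P := finite_op l in lfix vfix.
have SP x : S x \in fixed_by P.
  have [c ->] := Sv x; rewrite inE linear_sum; apply/eqP/eq_bigr => i _.
  by rewrite linearZ/= vfix// codom_f.
pose S0 x : fixed_banach P := FixedSpace (SP x).
have S0P : S0 \in bounded_linear.
  apply/asboolP; split=> [a x y|].
    by apply/val_inj => /=; rewrite linearP.
  by exists `|S| => x; exact: opnormP.
exists (fixed_banach P), (fixed_incl P), (Bop S0P).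
split=> //; last exact: bopP.
exists [seq (q.1 \bo fixed_incl P, insubd (0 : fixed_space P) q.2) | q <- l].
move=> w.
apply/val_inj; rewrite -[val _]/(fixed_incl P _) -[val w]/(fixed_val w).
rewrite finite_opE big_map linear_sum.
have /eqP <- := fixed_valP w; rewrite finite_opE; apply: eq_big_seq => q ql.
rewrite linearZ; congr (_ *: _); apply: insubdK; rewrite inE.
by apply/eqP; exact: lfix.
Qed.

End Factorization.

(** * Local reflexivity *)

Section LocalReflexivity.
Context {R : realType} {s : scalar_kind}.
Local Notation K := (scalar_field R s).
Implicit Types (X Y Z E : banach R s).

Lemma dualZ Y (f : dual Y) a y : f (a *: y) = a * f y.
Proof. exact: linearZ. Qed.

Lemma dual_almost_norming Y (h : dual Y) d : 0 < d ->
  exists2 y, rnorm y <= 1 & rnorm h - d <= to_real (h y).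
Proof.
move=> d0; apply: contrapT => nh; set c := rnorm h - d.
have hc y : rnorm y <= 1 -> to_real (h y) < c.
  by move=> y1; rewrite ltNge; apply/negP => ?; apply: nh; exists y.
have c0 : 0 < c.
  by have := hc 0; rewrite linear0 to_real0 rnorm0; apply; exact: ler01.
suff : rnorm h <= c by rewrite /c; lra.
apply: rnorm_bop_le => [|y]; first exact: ltW.
apply: rnorm_le_of_re y => [||y]; [exact: bop_linear|exact: ltW|].
have [->|y0] := eqVneq y 0; first by rewrite linear0 to_real0 rnorm0 mulr0.
have y_gt0 : 0 < rnorm y by rewrite rnorm_gt0.
have yV0 : 0 <= (rnorm y)^-1 by rewrite invr_ge0 rnorm_ge0.
have := hc (of_real (rnorm y)^-1 *: y).
rewrite rnorm_realZ// mulVf ?gt_eqF// => /(_ (lexx _)) /ltW.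
by rewrite linearZ to_realZ ler_pdivrMl// mulrC.
Qed.

Lemma dual_eq0_of_re Y (h : dual Y) : (forall y, to_real (h y) = 0) -> h = 0.
Proof.
move=> h0; apply: rnorm_eq0; apply/le_anti; rewrite rnorm_ge0 andbT.
apply: rnorm_bop_le => // y.
apply: rnorm_le_of_re y => // [|y]; first exact: bop_linear.
by rewrite h0 mul0r.
Qed.

Lemma sublinear_max_rnorm (V : normedModType K) (I : finType) (c : R) :
  0 <= c ->
  sublinear (fun z : realified {ffun I -> V} =>
               c * \big[Order.max/0]_i rnorm ((z : {ffun I -> V}) i)).
Proof.
move=> c0; split=> [x y|t x t0].
  rewrite -mulrDr ler_wpM2l//; apply: bigmax_le => [|i _].
    by rewrite addr_ge0//; apply: bigmax_ge_id.
  by rewrite ffunE (le_trans (ler_rnormD _ _))// lerD//; apply: le_bigmax.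
rewrite mulrCA ler_wpM2l//; apply: bigmax_le => [|i _].
  by rewrite mulr_ge0 ?(ltW t0)//; apply: bigmax_ge_id.
rewrite ffunE rnorm_realZ ?(ltW t0)// ler_wpM2l ?(ltW t0)//.
exact: le_bigmax.
Qed.

(** [J] commutes with expansions in coordinates, so the left-hand side depends
    only on the functionals [sum_i f (a_i) g_i], for [f] in the dual of [E]. *)
Lemma pairing_expand E Y (J : bop E (dual (dual Y))) (l : seq (dual E * E))
    (I : finType) (a : I -> E) (g : I -> dual Y) :
    (forall w, finite_op l w = w) ->
  \sum_i J (a i) (g i) =
  \sum_(q <- l) J q.2 (\sum_i q.1 (a i) *: g i).
Proof.
move=> lE; under [RHS]eq_bigr do rewrite linear_sum.
rewrite exchange_big; apply: eq_bigr => i _.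
rewrite -{1}(lE (a i)) finite_opE linear_sum bop_sumE.
by apply: eq_bigr => q _; rewrite !linearZ.
Qed.

(** A weak form of the principle of local reflexivity. If every [U] of norm at
    most [r] violated the inequality, then [U |-> Re sum g_i (U a_i)] would be
    dominated by a multiple of the maximum of [|U v|] over a net of the ball of
    [E]. By Hahn-Banach it is then a finite sum of functionals
    [U |-> Re h_v (U v)] whose total norm is too small, and this representation
    persists when [U] is replaced by [J], with values in the bidual. *)
Lemma local_reflexivity E Y (J : bop E (dual (dual Y))) n
    (a : 'I_n -> E) (g : 'I_n -> dual Y) r e :
    finite_dimensional E -> (forall w, rnorm (J w) <= rnorm w) ->
    1 < r -> 0 < e ->
  exists2 U : bop E Y, rnorm U <= r &
    \sum_i to_real (J (a i) (g i)) - e <= \sum_i to_real (g i (U (a i))).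
Proof.
move=> fE J1 r1 e0; apply: contrapT => noU.
have r0 : 0 < r by lra.
pose phi (U : bop E Y) := \sum_i to_real (g i (U (a i))).
have phiD U V : phi (U + V) = phi U + phi V.
  rewrite /phi -big_split; apply: eq_bigr => i _.
  by rewrite bopDE linearD raddfD.
have phiZ t U : phi (of_real t *: U) = t * phi U.
  rewrite /phi mulr_sumr; apply: eq_bigr => i _.
  by rewrite bopZE linearZ to_realZ.
set beta := \sum_i to_real (J (a i) (g i)) in noU.
pose B := beta - e.
have phi_lt U : rnorm U <= r -> phi U < B.
  by move=> Ur; rewrite ltNge; apply/negP => ?; apply: noU; exists U.
have B0 : 0 < B.
  have := phi_lt 0; rewrite rnorm0 (ltW r0) => /(_ isT); congr (_ < _).
  by rewrite /phi big1// => i _; rewrite bop0E linear0 to_real0.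
(* With a [1 - 1/r]-net of the ball, [|U v| <= 1] on the net gives
   [|U| <= r]. *)
have rV0 : 0 < 1 - r^-1 by rewrite subr_gt0 invf_lt1.
have [b [b1 bnet]] := unit_ball_net fE rV0.
pose m := size b; pose v (j : 'I_m) := tnth (in_tuple b) j.
have v1 j : rnorm (v j) <= 1 by apply: b1; exact: mem_tnth.
pose L (U : bop E Y) : realified {ffun 'I_m -> Y} := [ffun j => U (v j)].
pose q (z : realified {ffun 'I_m -> Y}) :=
  \big[Order.max/0]_j rnorm ((z : {ffun 'I_m -> Y}) j).
have q0 z : 0 <= q z by exact: bigmax_ge_id.
have phi_q U : phi U <= B * q (L U).
  rewrite leNgt; apply/negP => qphi.
  pose t := phi U / B.
  have qt : q (L U) < t by rewrite ltr_pdivlMr// mulrC.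
  have t0 : 0 < t by rewrite (le_lt_trans (q0 (L U))).
  suff : phi (of_real t^-1 *: U) < B.
    have phi0 : 0 < phi U by rewrite (le_lt_trans _ qphi)// mulr_ge0 ?(ltW B0).
    by rewrite phiZ /t invf_div divfK ?gt_eqF// ltxx.
  apply: phi_lt.
  have : (1 - (1 - r^-1)) * rnorm (of_real t^-1 *: U) <= 1.
    apply: (@rnorm_bop_net _ _ _ _ _ b) => //.
      by rewrite ltrBlDr ltrDl invr_gt0.
    move=> w wb; have [j ->] : exists j, w = v j.
      have wj : (index w b < m)%N by rewrite index_mem.
      by exists (Ordinal wj); rewrite /v (tnth_nth 0) nth_index.
    rewrite bopZE rnorm_realZ ?invr_ge0 ?(ltW t0)// ler_pdivrMl// mulr1.
    rewrite (le_trans _ (ltW qt))// /q (le_trans _ (le_bigmax _ _ j))//.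
    by rewrite ffunE.
  by rewrite opprB addrC subrK ler_pdivrMl// mulr1.
(* The cone is the graph of [phi], transported by [L]: [u] extends [phi]. *)
pose G z c := exists2 U, z = L U & c = phi U.
have LD U V : L (U + V) = L U + L V by apply/ffunP => j; rewrite !ffunE.
have LZ t U : L (of_real t *: U) = t *: L U by apply/ffunP => j; rewrite !ffunE.
have cG : cone G.
  split.
  - exists (of_real 0 *: 0); rewrite ?LZ ?phiZ ?scale0r ?mul0r//.
  - move=> x y c d [U -> ->] [V -> ->].
    by exists (U + V); rewrite ?LD ?phiD.
  - move=> t x c t0 [U -> ->].
    by exists (of_real t *: U); rewrite ?LZ ?phiZ.
have [|u [lu up Gu]] :=
    sandwich (sublinear_max_rnorm Y 'I_m (ltW B0)) cG.
  by move=> _ _ [U -> ->]; exact: phi_q.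
have [|h hu] := @dual_of_real_functional_ffun _ _ _ _ u B lu.
  move=> z; apply: le_trans (up z) _; rewrite ler_wpM2l ?(ltW B0)//.
  apply: bigmax_le => [|j _]; first by apply: sumr_ge0 => j _; exact: rnorm_ge0.
  by rewrite (bigD1 j)//= lerDl; apply: sumr_ge0 => i _; exact: rnorm_ge0.
have phiE U : phi U = u (L U).
  apply/le_anti; rewrite Gu/=; last by exists U.
  have := Gu (L (of_real (-1) *: U)) _ (ex_intro2 _ _ _ erefl erefl).
  rewrite phiZ LZ mulN1r lerNl => phiN; apply: le_trans phiN.
  have := lu (-1) (L U) 0; rewrite !addr0 (linear_fun0 lu) addr0 => ->.
  by rewrite [_ *: _]mulN1r opprK.
(* The sum of the norms is the norm dual to the maximum norm. *)
have hB : \sum_j rnorm (h j) <= B.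
  apply/ler_addgt0Pr => d d0.
  have dm : 0 < d / m.+1%:R by rewrite divr_gt0.
  have /fin_all_exists2[y y1 hy] j := dual_almost_norming (h j) dm.
  have : \sum_j (rnorm (h j) - d / m.+1%:R) <= B.
    rewrite (le_trans (ler_sum _ (fun j _ => hy j)))//.
    have := up [ffun j => y j]; rewrite hu.
    under eq_bigr do rewrite ffunE.
    move=> /le_trans; apply; rewrite -[leRHS]mulr1 ler_wpM2l ?(ltW B0)//.
    by apply: bigmax_le => // j _; rewrite ffunE.
  rewrite sumrB sumr_const card_ord -[_ *+ m]mulr_natr lerBlDr.
  move=> /le_trans; apply; rewrite lerD2l.
  by rewrite mulrAC ler_pdivrMr// ler_wpM2l ?(ltW d0)// ler_nat.
(* Test [phi U = u (L U)] on the rank one operators [f (-) y]. *)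
have hg (f : dual E) : \sum_j f (v j) *: h j = \sum_i f (a i) *: g i.
  apply/eqP; rewrite -subr_eq0; apply/eqP; apply: dual_eq0_of_re => y.
  have := phiE (rank1 f y); rewrite hu /phi.
  under [RHS]eq_bigr do rewrite ffunE dualZ.
  under [LHS]eq_bigr do rewrite dualZ.
  have -> : (\sum_j f (v j) *: h j - \sum_i f (a i) *: g i) y
      = \sum_j f (v j) * h j y - \sum_i f (a i) * g i y.
    by rewrite bopDE bopNE !bop_sumE.
  move=> phiE1; apply/eqP; rewrite raddfB subr_eq0 !raddf_sum; apply/eqP.
  exact: esym phiE1.
have [l lE] := fE.
have : beta <= \sum_j rnorm (h j).
  rewrite /beta -raddf_sum (pairing_expand J a g lE).
  under eq_bigr do rewrite -hg.
  rewrite -(pairing_expand J v h lE) raddf_sum; apply: ler_sum => j _.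
  rewrite (le_trans (to_real_le_norm _))// -/(rnorm _).
  rewrite (le_trans (rnorm_bop _ _))// ler_piMl ?rnorm_ge0//.
  exact: le_trans (J1 _) (v1 j).
rewrite /B in hB; lra.
Qed.

End LocalReflexivity.

(** * Finite rank operators and Banach operator ideals *)

Section Ideals.
Context {R : realType} {s : scalar_kind}.
Local Notation K := (scalar_field R s).
Implicit Types (X Y Z E : banach R s).
Variable A : banach_ideal R s.

Lemma finite_rankP X Y (S : bop X Y) :
  finite_rank S <-> exists l : seq (dual X * Y), S = finite_op l.
Proof.
split=> [fS|[l ->]].
  have [E [J [S0 [_ [l lE] ->]]]] := finite_rank_factor fS.
  exists [seq (q.1 \bo S0, J q.2) | q <- l]; apply: bopP => x.
  apply: etrans (esym (congr1 J (lE (S0 x)))) _.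
  rewrite !finite_opE big_map linear_sum.
  by apply: eq_bigr => q _; rewrite linearZ.
exists (size l), (fun i => (tnth (in_tuple l) i).2) => x.
exists (fun i => (tnth (in_tuple l) i).1 x).
by rewrite finite_opE big_tnth.
Qed.

Lemma finite_rankD X Y (S T : bop X Y) :
  finite_rank S -> finite_rank T -> finite_rank (S + T).
Proof.
move=> /finite_rankP[l ->] /finite_rankP[l' ->]; apply/finite_rankP.
by exists (l ++ l'); rewrite /finite_op big_cat.
Qed.

Lemma finite_rank_comp W X Y Z (U : bop Y Z) (T : bop X Y) (S : bop W X) :
  finite_rank T -> finite_rank (U \bo T \bo S).
Proof.
move=> /finite_rankP[l ->]; apply/finite_rankP.
exists [seq (q.1 \bo S, U q.2) | q <- l]; apply: bopP => x.
transitivity (U (finite_op l (S x))) => //.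
rewrite !finite_opE big_map linear_sum.
by apply: eq_bigr => q _; rewrite linearZ.
Qed.

Lemma finite_rankZ X Y a (T : bop X Y) : finite_rank T -> finite_rank (a *: T).
Proof.
move=> fT; rewrite (_ : a *: T = (a *: bop_id Y) \bo T \bo bop_id X).
  exact: finite_rank_comp.
exact: bopP.
Qed.

(** Rank one operators factor through the identity of the scalar field. *)
Lemma finite_rank_ideal X Y (S : bop X Y) : finite_rank S -> ideal_mem A S.
Proof.
move=> /finite_rankP[l ->]; apply: big_ind => [||q _].
- rewrite (_ : 0 = 0 \bo bop_id K \bo 0); last exact: bopP.
  exact: ideal_mem_comp (ideal_id A).
- exact: ideal_memD.
- pose y : bop K Y := rank1 (bop_id K) q.2.
  rewrite (_ : rank1 _ _ = y \bo bop_id K \bo q.1); last exact: bopP.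
  exact: ideal_mem_comp (ideal_id A).
Qed.

Definition inorm X Y (T : bop X Y) : R := to_real (ideal_norm A T).

Lemma inorm_ge0 X Y (T : bop X Y) : ideal_mem A T -> 0 <= inorm T.
Proof. by move=> AT; apply: ge0_to_real; exact: ideal_norm_ge0. Qed.

Lemma inormD X Y (S T : bop X Y) : ideal_mem A S -> ideal_mem A T ->
  inorm (S + T) <= inorm S + inorm T.
Proof.
by move=> AS AT; rewrite /inorm -raddfD; apply: to_real_le; exact: ideal_normD.
Qed.

Lemma inorm_realZ X Y t (T : bop X Y) : ideal_mem A T -> 0 <= t ->
  inorm (of_real t *: T) = t * inorm T.
Proof.
move=> AT t0; rewrite /inorm ideal_normZ// ger0_norm ?of_real_ge0//.
exact: to_realZ.
Qed.

Lemma inorm_comp W X Y Z (U : bop Y Z) (T : bop X Y) (S : bop W X) :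
  ideal_mem A T -> inorm (U \bo T \bo S) <= rnorm U * inorm T * rnorm S.
Proof.
move=> AT; have T0 := ideal_norm_ge0 AT.
rewrite -(@of_real_le R s) !of_realM !of_real_rnorm !to_realK//.
  exact: ideal_norm_comp.
exact/ideal_norm_ge0/ideal_mem_comp.
Qed.

Lemma rnorm_bop_id X : rnorm (bop_id X) <= 1.
Proof. by apply: rnorm_bop_le => // x; rewrite mul1r. Qed.

Lemma inorm_compl X Y Z (U : bop Y Z) (T : bop X Y) :
  ideal_mem A T -> inorm (U \bo T) <= rnorm U * inorm T.
Proof.
move=> AT; rewrite (_ : U \bo T = U \bo T \bo bop_id X); last exact: bopP.
rewrite (le_trans (inorm_comp _ _ AT))// ler_piMr ?rnorm_bop_id//.
by rewrite mulr_ge0 ?rnorm_ge0 ?inorm_ge0.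
Qed.

Lemma net_filter_proper (I : Type) (le : I -> I -> Prop) :
  directed le -> ProperFilter (net_filter le).
Proof.
move=> [[i0] leR leT leD].
apply: filter_from_proper => [|i _]; last by exists i.
apply: filter_from_filter; first by exists i0.
move=> i j _ _; have [k [ik jk]] := leD i j; exists k => // l kl.
by split; [exact: leT ik kl|exact: leT jk kl].
Qed.

(** Nets can be eliminated: approximability is a statement about finitely many
    vectors and one tolerance, and conversely these data index a net. *)
Lemma finite_rank_approxP lam X Y (T : bop X Y) :
  finite_rank_approx A lam T <->
  forall n (x : 'I_n -> X) e, 0 < e ->
    exists S : bop X Y, [/\ finite_rank S, inorm S <= lam * inorm T + e
      & forall i, rnorm (S (x i) - T (x i)) <= e].
Proof.
split.
  move=> [I [le [Tn [dirle frT cvT supT]]]] n x e e0.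
  have PF := net_filter_proper dirle.
  have [i1 i1e] :
      exists i, forall j, le i j -> inorm (Tn j) <= lam * inorm T + e.
    apply: contrapT => noi.
    suff : ((lam * inorm T + e)%:E <= (lam * inorm T)%:E)%E.
      by rewrite lee_fin; lra.
    apply: le_trans supT; apply: le_ereal_inf_tmp => _ [i _ <-].
    have /existsNP[j /not_implyP[ij /negP]] :
        ~ forall j, le i j -> inorm (Tn j) <= lam * inorm T + e.
      by move=> ie; apply: noi; exists i.
    rewrite -ltNge => /ltW Tj; apply: le_ereal_sup_tmp.
    by exists (inorm (Tn j))%:E; [exists j|rewrite lee_fin].
  have near_x k : net_filter le [set i | rnorm (Tn i (x k) - T (x k)) <= e].
    have e0' : 0 < of_real e :> K by rewrite of_real_gt0.
    have := cvT (x k) => /cvgrPdist_le /(_ _ e0').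
    by apply: filterS => i /=; rewrite -rnorm_le -rnormN opprB.
  have near_i1 : net_filter le [set j | le i1 j] by exists i1.
  have [j [ij jx]] := filter_ex (filterI near_i1 (filter_forall _ near_x)).
  exists (Tn j); split=> //; exact: i1e.
move=> approx; pose I := (seq X * nat)%type.
have e0 n : 0 < n.+1%:R^-1 :> R by rewrite invr_gt0.
have /choice[Tn hT] (i : I) : exists S : bop X Y, [/\ finite_rank S,
    inorm S <= lam * inorm T + i.2.+1%:R^-1
    & forall x, x \in i.1 -> rnorm (S x - T x) <= i.2.+1%:R^-1].
  have [S [fS nS xS]] := approx _ (tnth (in_tuple i.1)) _ (e0 i.2).
  exists S; split=> // x /seq_tnthP[k ->]; exact: xS.
pose le (i j : I) := {subset i.1 <= j.1} /\ (i.2 <= j.2)%N.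
have leV i j : le i j -> j.2.+1%:R^-1 <= i.2.+1%:R^-1 :> R.
  by move=> [_ ij]; rewrite lef_pV2 ?posrE// ler_nat ltnS.
have arch (e : R) : 0 < e -> exists n, n.+1%:R^-1 <= e.
  move=> ep; exists (Num.truncn e^-1).
  rewrite -[leRHS]invrK lef_pV2 ?posrE ?invr_gt0// ltW//.
  by rewrite -Num.Theory.truncn_le_nat.
have dirle : directed le.
  split.
  - exact: inhabits ([::], 0%N).
  - by move=> i; split.
  - move=> i j k [ij ij'] [jk jk']; split; last exact: leq_trans jk'.
    by move=> x /ij/jk.
  - move=> i j; exists (i.1 ++ j.1, maxn i.2 j.2); split; split=> /=.
    + by move=> x xi; rewrite mem_cat xi.
    + exact: leq_maxl.
    + by move=> x xj; rewrite mem_cat xj orbT.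
    + exact: leq_maxr.
have PF := net_filter_proper dirle.
exists I, le, Tn; split=> //.
- by move=> i; case: (hT i).
- move=> x; apply/cvgrPdist_le => e ep.
  have [n ne] := arch _ (to_real_gt0 ep).
  exists ([:: x], n) => // j lej /=.
  rewrite -normrN opprB -(to_realK (ltW ep)) -rnorm_le.
  have [_ _ xT] := hT j; rewrite (le_trans (xT x _))//.
    by case: lej => + _; apply; rewrite inE.
  exact: le_trans (leV _ _ lej) ne.
- apply/lee_addgt0Pr => e ep; have [n ne] := arch _ ep.
  apply: le_trans (ereal_inf_lbound _) _; first by exists ([::], n).
  apply: ge_ereal_sup => _ [j lej <-]; rewrite -EFinD lee_fin.
  have [_ nT _] := hT j; rewrite (le_trans nT)// lerD2l.
  exact: le_trans (leV _ _ lej) ne.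
Qed.

Lemma eval_subproof Y (y : Y) : (fun f : dual Y => f y) \in bounded_linear.
Proof.
apply/asboolP; split=> [//|]; exists `|y| => f.
by rewrite mulrC; exact: opnormP.
Qed.

Lemma bidual_embedding_subproof Y :
  (fun y : Y => Bop (eval_subproof y) : dual (dual Y)) \in bounded_linear.
Proof.
apply/asboolP; split=> [a x y|].
  by apply: bopP => f; rewrite bopDE bopZE /= linearP.
exists 1 => y; rewrite mul1r; apply: opnorm_le => // f.
by rewrite mulrC; exact: (opnormP (f : bop Y K) y).
Qed.

Definition bidual_embedding Y : bop Y (dual (dual Y)) :=
  Bop (bidual_embedding_subproof Y).

Lemma rnorm_bidual_embedding Y : rnorm (bidual_embedding Y) <= 1.
Proof.
apply: rnorm_bop_le => // y; rewrite mul1r; apply: to_real_le.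
by apply: opnorm_le => // f; rewrite mulrC; exact: (opnormP (f : bop Y K) y).
Qed.

(** Injectivity lets a finite rank operator into [Y^**] be regarded, without
    changing its ideal norm, as an operator into its finite-dimensional range,
    and local reflexivity then pushes that range into [Y]. *)
Lemma finite_rank_pull_back X Y (T : bop X (dual (dual Y))) n
    (x : 'I_n -> X) (f : 'I_n -> dual Y) r e :
    injective_ideal A -> finite_rank T -> 1 < r -> 0 < e ->
  exists S : bop X Y, [/\ finite_rank S, inorm S <= r * inorm T
    & \sum_i to_real (T (x i) (f i)) - e <= \sum_i to_real (f i (S (x i)))].
Proof.
move=> injA fT r1 e0.
have [E [J [T0 [isoJ fE TE]]]] := finite_rank_factor fT.
have J1 w : rnorm (J w) <= rnorm w by rewrite /rnorm isoJ.
have [U Ur UJ] := local_reflexivity (fun i => T0 (x i)) f fE J1 r1 e0.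
have AT := finite_rank_ideal fT.
have [AT0 nT0] : ideal_mem A T0 /\ inorm T0 = inorm T.
  have := AT; rewrite {1}TE => /(injA _ _ _ _ _ isoJ)[AT0 nT0].
  by split=> //; rewrite /inorm nT0 -TE.
exists (U \bo T0); split; last 1 first.
- by rewrite TE.
- have [l lE] := fE.
  rewrite (_ : U \bo T0 = U \bo finite_op l \bo T0).
    by apply: finite_rank_comp; apply/finite_rankP; exists l.
  by apply: bopP => z /=; rewrite lE.
- rewrite (le_trans (inorm_compl _ AT0))// nT0 ler_wpM2r// inorm_ge0//.
Qed.

End Ideals.

Theorem proposition3p3 (R : realType) (s : scalar_kind)
    (A : banach_ideal R s) (lam : R) (X : banach R s) :
  injective_ideal A -> 1 <= lam ->
  (local_bap A lam X <->
   forall (Y : banach R s) (T : bop X (dual (dual Y))),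
     ideal_mem A T -> finite_rank_approx A lam T).
Proof.
move=> injA lam1; split=> [bapX Y T|bidual Y T AT]; first exact: bapX.
apply/finite_rank_approxP => n x e e0.
pose kT := bidual_embedding Y \bo T.
have AkT : ideal_mem A kT.
  rewrite /kT (_ : _ \bo T = bidual_embedding Y \bo T \bo bop_id X).
    exact: ideal_mem_comp.
  exact: bopP.
have kT_le : inorm A kT <= inorm A T.
  rewrite (le_trans (inorm_compl _ AT))// ler_piMl ?inorm_ge0//.
  exact: rnorm_bidual_embedding.
have lamT0 : 0 <= lam * inorm A T by rewrite mulr_ge0 ?inorm_ge0//; lra.
set mu := lam * inorm A T + e.
(* The slack [e] between [mu] and the bound [lam |T|] pays for the factor
   [r > 1] of local reflexivity. *)
pose C := [set S : bop X Y | finite_rank S /\ inorm A S <= mu].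
have convC (S S' : bop X Y) t : 0 <= t -> t <= 1 -> C S -> C S' ->
    C (of_real t *: S + of_real (1 - t) *: S').
  move=> t0 t1 [fS nS] [fS' nS']; have t1' : 0 <= 1 - t by rewrite subr_ge0.
  split; first by apply: finite_rankD; exact: finite_rankZ.
  have AS := finite_rank_ideal A fS; have AS' := finite_rank_ideal A fS'.
  rewrite (le_trans (inormD (ideal_memZ _ AS) (ideal_memZ _ AS')))//.
  rewrite !inorm_realZ//.
  have : t * inorm A S + (1 - t) * inorm A S' <= t * mu + (1 - t) * mu.
    by rewrite lerD// ler_wpM2l.
  by move=> /le_trans; apply; rewrite -mulrDl addrC subrK mul1r.
have [m z f d d0|S [fS nS] xS] :=
  pointwise_approx_of_weak (T := T) convC _ x e0; last by exists S.
pose M := \sum_i rnorm (f i) + 1.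
have M0 : 0 < M by rewrite ltr_wpDl// sumr_ge0// => i _; exact: rnorm_ge0.
pose d' := Num.min (e / 2) (d / 2 / M).
have d'0 : 0 < d' by rewrite lt_min !divr_gt0.
have [T' [fT' nT' zT']] :=
  (finite_rank_approxP _ _ _).1 (bidual Y kT AkT) _ z _ d'0.
pose mu' := lam * inorm A T + e / 2.
have mu'0 : 0 < mu' by rewrite /mu'; lra.
have T'mu : inorm A T' <= mu'.
  rewrite (le_trans nT')// lerD//; first by rewrite ler_wpM2l//; lra.
  by rewrite ge_min lexx.
have r1 : 1 < mu / mu' by rewrite ltr_pdivlMr// mul1r /mu /mu'; lra.
have d20 : 0 < d / 2 by rewrite divr_gt0.
have [S [fS nS zS]] := finite_rank_pull_back z f injA fT' r1 d20.
exists S.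
  split=> //; rewrite (le_trans nS)// mulrAC ler_pdivrMr//.
  by rewrite ler_wpM2l// /mu; lra.
have :
    \sum_i to_real (f i (T (z i))) - \sum_i to_real (T' (z i) (f i)) <= d / 2.
  rewrite -sumrB.
  have le1 i : to_real (f i (T (z i))) - to_real (T' (z i) (f i))
      <= d' * rnorm (f i).
    rewrite -raddfB (le_trans (to_real_le_norm _))// -/(rnorm _).
    have -> : f i (T (z i)) - T' (z i) (f i) = (kT (z i) - T' (z i)) (f i).
      by [].
    rewrite (le_trans (rnorm_bop _ _))// ler_wpM2r ?rnorm_ge0//.
    by rewrite -rnormN opprB.
  rewrite (le_trans (ler_sum _ (fun i _ => le1 i)))// -mulr_sumr.
  have : d' <= d / 2 / M by rewrite ge_min lexx orbT.
  rewrite ler_pdivlMr// => /(le_trans _); apply.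
  by rewrite ler_wpM2l ?(ltW d'0)// /M lerDl.
lra.
Qed.
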